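(* Let $V=\{v_1,\dots,v_m\}\subset\mathbb{R}^d$ be a finite set of $m$ points and let $r\in\mathbb{R}^d$. Let $\mathcal{B}(V,r)$ denote the poset, ordered by inclusion, of all weakly $r$-balanced subsets $S\subset V$ with $S\neq V$, and let $\overline{\mathcal{B}}(V,r)$ denote the poset, ordered by inclusion, of all $r$-balanced subsets $S\subset V$ with $S\neq V$. Suppose $\mathcal{B}(V,r)$ is nonempty, $r\in\mathrm{relint}(\mathrm{conv}(V))$, and the affine hull of $\mathrm{conv}(V)$ has dimension $k$. Then \[ \Delta\mathcal{B}(V,r)\simeq\Delta\overline{\mathcal{B}}(V,r)\simeq S^{m-k-2}, \] where $\simeq$ denotes homotopy equivalence.
   Context: A subset $S\subset V$ is called weakly $r$-balanced if $r\in\mathrm{conv}(S)$, and $r$-balanced if $r\in\mathrm{relint}(\mathrm{conv}(S))$ (relative interior taken within the affine hull of $S$). For a poset $\mathcal{P}$, $\Delta\mathcal{P}$ denotes its order complex (the simplicial complex of finite chains of $\mathcal{P}$). *)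

(* Defs.v *)
From HB Require Import structures.
From mathcomp Require Import all_boot all_order all_algebra.
From mathcomp Require Import all_classical all_reals all_analysis.
Set Implicit Arguments. Unset Strict Implicit. Unset Printing Implicit Defensive.
Import Order.TTheory GRing.Theory Num.Theory.
Import numFieldNormedType.Exports.
Local Open Scope classical_set_scope.
Local Open Scope ring_scope.

Section Defs.
Variables (R : realType) (m d : nat).
Variable v : 'I_m -> 'rV[R]_d.

Definition conv (S : {set 'I_m}) : set 'rV[R]_d :=
  [set x | exists l : 'I_m -> R,
     [/\ forall i, 0 <= l i, forall i, i \notin S -> l i = 0,
         \sum_i l i = 1 & x = \sum_i l i *: v i]].

Definition aff (S : {set 'I_m}) : set 'rV[R]_d :=
  [set x | exists l : 'I_m -> R,
     [/\ forall i, i \notin S -> l i = 0,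
         \sum_i l i = 1 & x = \sum_i l i *: v i]].

Definition relint (C A : set 'rV[R]_d) : set 'rV[R]_d :=
  [set x | C x /\ exists2 e : R, 0 < e &
     forall y, A y -> `|y - x| < e -> C y].

Definition weakly_balanced (r : 'rV[R]_d) (S : {set 'I_m}) : Prop := conv S r.

Definition balanced (r : 'rV[R]_d) (S : {set 'I_m}) : Prop :=
  relint (conv S) (aff S) r.

Definition aff_dim : nat :=
  \dim (<< [seq v i - v j | i <- enum 'I_m, j <- enum 'I_m] >>%VS).

Definition B_poset (r : 'rV[R]_d) (S : {set 'I_m}) : Prop :=
  S != finset.setT /\ weakly_balanced r S.
Definition Bbar_poset (r : 'rV[R]_d) (S : {set 'I_m}) : Prop :=
  S != finset.setT /\ balanced r S.
End Defs.

(* Geometric realization of the order complex of a finite poset (T, le)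
   restricted to the elements satisfying P: points of the standard simplex
   in R^T (coordinates indexed via enum_val) whose support is a chain of P. *)
Definition order_complex_realization (R : realType) (T : finType)
  (le : rel T) (P : T -> Prop) : set 'rV[R]_#|T| :=
  [set t | [/\ forall i, 0 <= t ord0 i,
              \sum_i t ord0 i = 1,
              forall i, t ord0 i != 0 -> P (enum_val i) &
              forall i j, t ord0 i != 0 -> t ord0 j != 0 ->
                 le (enum_val i) (enum_val j) || le (enum_val j) (enum_val i)]].

(* The n-dimensional unit sphere S^n in Euclidean R^(n+1), for n : int;
   S^n is empty when n < 0. *)
Definition sphere (R : realType) (n : int) : set 'rV[R]_(absz (n + 1)) :=
  [set x | (0 <= n + 1)%R /\ \sum_i x ord0 i ^+ 2 = 1].

Definition homotopic (R : realType) (X Y : topologicalType) (A : set X)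
  (B : set Y) (f g : X -> Y) : Prop :=
  exists H : R * X -> Y,
    [/\ {within [set p | 0 <= p.1 <= 1 /\ A p.2], continuous H},
        forall x, A x -> H (0, x) = f x,
        forall x, A x -> H (1, x) = g x &
        forall t x, 0 <= t <= 1 -> A x -> B (H (t, x))].

Definition homotopy_equivalent (R : realType) (X Y : topologicalType)
  (A : set X) (B : set Y) : Prop :=
  exists (f : X -> Y) (g : Y -> X),
    [/\ {within A, continuous f} /\ f @` A `<=` B,
        {within B, continuous g} /\ g @` B `<=` A,
        homotopic R A A (g \o f) id &
        homotopic R B B (f \o g) id].
Arguments order_complex_realization R {T} le P.
Arguments sphere R n : clear implicits.
Arguments homotopy_equivalent R {X Y} A B.

(* Main.v *)
(* Let L be the polytope of all l >= 0 with sum l_i = 1 and sum l_i v_i = r. A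
   set S is weakly balanced iff it contains the support of a point of L, and
   balanced iff it is the support of one. As r lies in the relative interior, L
   contains a positive point l0, and L is the part of l0 + W in the nonnegative
   orthant, where W is the (m-k-1)-dimensional space of affine dependencies.

   From the order complex to the sphere: choose a point of L in every member S
   of the poset with support in S, extend affinely on chains, and project
   radially from l0; the image misses l0 because the members of a chain all
   avoid some index i.

   From the sphere to the order complex: follow the ray from l0 to the boundary
   point l of L, clip l / eps at 1, and take the chain of superlevel sets of the
   result. By compactness, for small eps every set {i | eps <= l_i} with l in L
   is weakly balanced, hence so are all these superlevel sets. For balanced
   sets, replace each member of the chain by the largest balanced set in it.

   Both homotopies are explicit: a straight line that keeps a coordinate
   negative on the sphere side, and a maximum of two functions in the cube
   [0,1]^m, where chains are encoded by functions, on the other side. *)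
Require Import Defs.
From HB Require Import structures.
From mathcomp Require Import all_boot all_order all_algebra.
From mathcomp Require Import all_classical all_reals all_analysis.
From mathcomp Require Import ring lra zify.
Import Order.TTheory GRing.Theory Num.Theory.
Import numFieldNormedType.Exports.
Local Open Scope classical_set_scope.
Local Open Scope ring_scope.

Set Implicit Arguments.
Unset Strict Implicit.

(** * Convergence of row vectors and of finite sums, products and maxima *)

Section Continuity.
Context {R : realType} {T : topologicalType}.

Lemma cvg_row (n : nat) (f : T -> 'I_n -> R) (x : T) :
  (forall j, f y j @[y --> x] --> f x j) ->
  (\row_j f y j : 'rV[R]_n) @[y --> x] --> (\row_j f x j : 'rV[R]_n).
Proof.
move=> fx; apply/cvgrPdist_lt => e e0.
have : \forall y \near x, forall j, `|f x j - f y j| < e.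
  apply: filter_forall => j.
  by move/cvgrPdist_lt : (fx j) => /(_ _ e0).
apply: filterS => y fy; rewrite [ltLHS]/Num.norm/= mx_normrE.
by apply/bigmax_ltP; split => // -[i j] _ /=; rewrite !mxE; exact: fy.
Qed.

Lemma cvg_coord (n : nat) (f : T -> 'rV[R]_n) (x : T) (j : 'I_n) :
  f y @[y --> x] --> f x -> f y ord0 j @[y --> x] --> f x ord0 j.
Proof.
by move=> fx; apply: (cvg_comp _ _ fx (@coord_continuous R 1 n ord0 j (f x))).
Qed.

Lemma cvg_sum (I : Type) (r : seq I) (P : pred I) (f : I -> T -> R) (x : T) :
  (forall i, P i -> f i y @[y --> x] --> f i x) ->
  \sum_(i <- r | P i) f i y @[y --> x] --> \sum_(i <- r | P i) f i x.
Proof.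
by move=> fx; apply: cvg_big => //; exact: (@add_continuous R^o).
Qed.

Lemma cvg_prod_scalar (I : Type) (r : seq I) (P : pred I) (f : I -> T -> R) (x : T) :
  (forall i, P i -> f i y @[y --> x] --> f i x) ->
  \prod_(i <- r | P i) f i y @[y --> x] --> \prod_(i <- r | P i) f i x.
Proof.
by move=> fx; apply: cvg_big => //; exact: mul_continuous.
Qed.

Lemma cvg_bigmax (I : Type) (r : seq I) (f : I -> T -> R) (x : T) :
  (forall i, f i y @[y --> x] --> f i x) ->
  \big[Num.max/0]_(i <- r) f i y @[y --> x] --> \big[Num.max/0]_(i <- r) f i x.
Proof.
move=> fx; apply: cvg_big => // -[a b].
by apply: continuous_max; [exact: cvg_fst|exact: cvg_snd].
Qed.

End Continuity.
Arguments cvg_coord {R T n f x} j _.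

(** * Continuous weights on the superlevel sets of a function in the cube *)

Section Weights.
Context {R : realType} {m : nat}.
Implicit Types (phi : 'rV[R]_m) (S : {set 'I_m}).

Definition cube : set 'rV[R]_m := [set phi | forall i, 0 <= phi ord0 i <= 1].

(* For [phi] in the cube this is positive exactly when [S] is a strict
   superlevel set of [phi] at some level in [0, 1[. *)
Definition weight phi S : R :=
  (\prod_i (if i \in S then phi ord0 i else 1 - phi ord0 i)) *
  \prod_i \prod_j (if (i \in S) && (j \notin S)
                   then Num.max 0 (phi ord0 i - phi ord0 j) else 1).

Lemma weight_ge0 phi S : cube phi -> 0 <= weight phi S.
Proof.
move=> cphi; rewrite mulr_ge0//.
  apply: prodr_ge0 => i _; have /andP[? ?] := cphi i.
  by case: ifPn => // _; rewrite subr_ge0.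
apply: prodr_ge0 => i _; apply: prodr_ge0 => j _.
by case: ifP => // _; rewrite le_max lexx.
Qed.

Lemma weight_neq0 phi S : weight phi S != 0 ->
  [/\ forall i, i \in S -> phi ord0 i != 0,
      forall i, phi ord0 i = 1 -> i \in S &
      forall i j, i \in S -> j \notin S -> phi ord0 j < phi ord0 i].
Proof.
rewrite mulf_eq0 negb_or => /andP[/prodf_neq0 w1 /prodf_neq0 w2].
split=> [i iS|i phi1|i j iS jS].
- by have := w1 i isT; rewrite iS.
- by have := w1 i isT; case: ifPn => //; rewrite phi1 subrr eqxx.
- have /prodf_neq0/(_ j isT) := w2 i isT; rewrite iS jS /=.
  by rewrite ltNge; apply: contraNN => ?; apply/eqP/max_idPl; rewrite subr_le0.
Qed.

(** The set where [phi] equals 1, possibly empty, always has positive weight. *)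
Lemma weight_sum_gt0 phi : cube phi -> 0 < \sum_S weight phi S.
Proof.
move=> cphi; pose S0 := [set i | phi ord0 i == 1]%SET.
rewrite (bigD1 S0)//= ltr_wpDr//; first by apply: sumr_ge0 => S _; exact: weight_ge0.
have lt1 i : i \notin S0 -> phi ord0 i < 1.
  by rewrite inE lt_neqAle => ->; have /andP[] := cphi i.
have eq1 i : i \in S0 -> phi ord0 i = 1 by rewrite inE => /eqP.
rewrite mulr_gt0//.
  apply: prodr_gt0 => i _; case: ifPn => iS; first by rewrite eq1.
  by rewrite subr_gt0 lt1.
apply: prodr_gt0 => i _; apply: prodr_gt0 => j _.
by case: ifP => // /andP[iS jS]; rewrite lt_max orbC eq1// subr_gt0 lt1.
Qed.

Lemma cvg_weight (T : topologicalType) (f : T -> 'rV[R]_m) (x : T) S :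
  f y @[y --> x] --> f x -> weight (f y) S @[y --> x] --> weight (f x) S.
Proof.
move=> fx; have fxi i := cvg_coord i fx.
apply: cvgM; apply: cvg_prod_scalar => i _.
  by case: ifP => // _; apply: cvgB => //; exact: cvg_cst.
apply: cvg_prod_scalar => j _; case: ifP => _; last exact: cvg_cst.
apply: (@continuous_max R T (fun=> 0) (fun y => f y ord0 i - f y ord0 j)).
  exact: cvg_cst.
exact: cvgB.
Qed.

End Weights.

(** * Passage between the cube and the order complex *)

Section OrderComplex.
Context {R : realType} {m : nat}.
Implicit Types (phi : 'rV[R]_m) (S : {set 'I_m}) (t : 'rV[R]_#|{set 'I_m}|)
  (P : {set 'I_m} -> Prop) (c : {set 'I_m} -> {set 'I_m}).

Local Notation realization P :=
  (order_complex_realization R (fun S T : {set 'I_m} => S \subset T) P).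

(** The normalized weights, transported along [c]. The map [c] will be [id] for weakly balanced sets
    and [core] for balanced ones. *)
Definition push c phi : 'rV[R]_#|{set 'I_m}| :=
  \row_j ((\sum_(S | c S == enum_val j) weight phi S) / \sum_S weight phi S).

(* The superlevel sets of [degree t] are the members of the chain supporting
   [t]; [push id] inverts [degree] only up to homotopy, as the weights are not
   the barycentric coordinates. *)
Definition degree t : 'rV[R]_m :=
  \row_i \sum_(j | i \in (enum_val j : {set 'I_m})) t ord0 j.

Lemma push_neq0 c phi j : push c phi ord0 j != 0 ->
  exists2 S, weight phi S != 0 & c S = enum_val j.
Proof.
rewrite mxE => h; apply: contrapT => nex; case/negP: h.
rewrite big1 ?mul0r// => S /eqP cS; apply/eqP/negPn/negP => wS.
by apply: nex; exists S.
Qed.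

(** Sets of positive weight are nested: a point [x] of [S] outside [S'] and a point [y] of [S']
    outside [S] would make [phi] strictly larger at each of them than at the other. A monotone [c]
    preserves the chain. *)
Lemma push_realization P c phi : cube phi ->
    {homo c : S T / S \subset T} ->
    (forall S, weight phi S != 0 -> P (c S)) ->
  realization P (push c phi).
Proof.
move=> cphi cM PcS; have w0 := weight_sum_gt0 cphi; split.
- move=> i; rewrite mxE divr_ge0 ?(ltW w0)// sumr_ge0// => S _.
  exact: weight_ge0.
- under eq_bigr do rewrite mxE.
  rewrite -mulr_suml (exchange_big_dep xpredT)//=.
  rewrite -[RHS](@divff _ (\sum_S weight phi S)) ?gt_eqF//.
  congr (_ / _); apply: eq_bigr => S _.
  rewrite (big_pred1 (enum_rank (c S)))// => j.
  by apply/eqP/eqP => [->|->]; rewrite ?enum_valK ?enum_rankK.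
- by move=> i /push_neq0[S wS <-]; exact: PcS.
- move=> i j /push_neq0[S wS <-] /push_neq0[S' wS' <-].
  have [/cM->//|/subsetPn[x xS xS']] := boolP (S \subset S').
  apply/orP; right; apply: cM; apply/fintype.subsetP => y yS'.
  apply: contraPT (erefl true) => yS.
  have [_ _ /(_ _ _ xS yS) lt1] := weight_neq0 wS.
  have [_ _ /(_ _ _ yS' xS')] := weight_neq0 wS'.
  by rewrite ltNge (ltW lt1).
Qed.

Lemma cvg_push (T : topologicalType) c (f : T -> 'rV[R]_m) (x : T) :
  cube (f x) -> f y @[y --> x] --> f x ->
  push c (f y) @[y --> x] --> push c (f x).
Proof.
move=> cfx fx; apply: cvg_row => j; apply: cvgM.
  by apply: cvg_sum => S _; exact: cvg_weight.
apply: cvgV; first by rewrite gt_eqF// weight_sum_gt0.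
by apply: cvg_sum => S _; exact: cvg_weight.
Qed.

Lemma cvg_degree (T : topologicalType) (f : T -> 'rV[R]_#|{set 'I_m}|) (x : T) :
  f y @[y --> x] --> f x -> degree (f y) @[y --> x] --> degree (f x).
Proof.
by move=> fx; apply: cvg_row => i; apply: cvg_sum => j _; exact: cvg_coord.
Qed.

Lemma degree_cube P t : realization P t -> cube (degree t).
Proof.
move=> [t0 t1 _ _] i; rewrite mxE sumr_ge0//= -t1.
by rewrite [leRHS](bigID (fun j => i \in (enum_val j : {set 'I_m})))//= lerDl sumr_ge0.
Qed.

Lemma degree_le P t i j : realization P t ->
  (forall S, t ord0 (enum_rank S) != 0 -> i \in S -> j \in S) ->
  degree t ord0 i <= degree t ord0 j.
Proof.
move=> [t0 _ _ _] ij; rewrite !mxE big_mkcond [leRHS]big_mkcond/=.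
apply: ler_sum => l _; case: ifPn => il; last by case: ifP.
have [->|tl] := eqVneq (t ord0 l) 0; first by case: ifP.
by rewrite ij// enum_valK.
Qed.

Lemma degree_eq1 P t i : realization P t ->
  (forall S, t ord0 (enum_rank S) != 0 -> i \in S) -> degree t ord0 i = 1.
Proof.
move=> [_ <- _ _] iS; rewrite mxE big_mkcond; apply: eq_bigr => l _.
have [->|tl] := eqVneq (t ord0 l) 0; first by case: ifP.
by rewrite iS// enum_valK.
Qed.

Lemma degree_eq0 t i :
  (forall S, t ord0 (enum_rank S) != 0 -> i \notin S) -> degree t ord0 i = 0.
Proof.
move=> iS; rewrite mxE big1// => l il; apply/eqP.
by apply: contraLR il => tl; rewrite iS// enum_valK.
Qed.

Lemma realization_neq0 P t : realization P t ->
  exists S, t ord0 (enum_rank S) != 0.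
Proof.
move=> [_ t1 _ _]; apply: contrapT => nex; have := oner_neq0 R.
rewrite -t1 big1 ?eqxx// => l _; apply/eqP/negPn/negP => tl.
by apply: nex; exists (enum_val l); rewrite enum_valK.
Qed.

Lemma realization_chain P t S S' : realization P t ->
    t ord0 (enum_rank S) != 0 -> t ord0 (enum_rank S') != 0 ->
  (S \subset S') || (S' \subset S).
Proof. by move=> [_ _ _ ch] tS /(ch _ _ tS); rewrite !enum_rankK. Qed.

(** Members of the support are comparable, so one of least cardinality is least for inclusion. *)
Lemma realization_min P t (D : pred {set 'I_m}) S1 : realization P t ->
    t ord0 (enum_rank S1) != 0 -> D S1 ->
  exists S, [/\ t ord0 (enum_rank S) != 0, D S &
    forall S', t ord0 (enum_rank S') != 0 -> D S' -> S \subset S'].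
Proof.
move=> tP tS1 DS1.
have E1 : (t ord0 (enum_rank S1) != 0) && D S1 by rewrite tS1.
case: (arg_minnP (P := fun S => (t ord0 (enum_rank S) != 0) && D S)
  (fun S : {set 'I_m} => #|S|) E1) => S /andP[tS DS] Smin.
exists S; split=> // S' tS' DS'.
have /orP[//|S'S] := realization_chain tP tS tS'.
have /eqP-> // : S' == S.
by rewrite eqEcard S'S Smin// tS'.
Qed.

Lemma realization_max P t (D : pred {set 'I_m}) S1 : realization P t ->
    t ord0 (enum_rank S1) != 0 -> D S1 ->
  exists S, [/\ t ord0 (enum_rank S) != 0, D S &
    forall S', t ord0 (enum_rank S') != 0 -> D S' -> S' \subset S].
Proof.
move=> tP tS1 DS1.
have E1 : (t ord0 (enum_rank S1) != 0) && D S1 by rewrite tS1.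
case: (arg_maxnP (P := fun S => (t ord0 (enum_rank S) != 0) && D S)
  (fun S : {set 'I_m} => #|S|) E1) => S /andP[tS DS] Smax.
exists S; split=> // S' tS' DS'.
have /orP[SS'|//] := realization_chain tP tS tS'.
have /eqP-> // : S == S'.
by rewrite eqEcard SS'; apply: Smax; rewrite tS'.
Qed.

(** Suppose [S] is not in the chain of [t]. It is still comparable to all members, so it fits
    strictly between consecutive ones [Sb] and [Sa]. The degree takes the same value on [S] outside
    [Sb] as on [Sa] outside [S], which contradicts the separation by [S]. If [Sb] or [Sa] is
    missing, the degree is 1 outside [S] or 0 inside [S] at some point. *)
Lemma weight_degree P t S : realization P t ->
  weight (degree t) S != 0 -> t ord0 (enum_rank S) != 0.
Proof.
move=> tP /weight_neq0[S0 S1 Slt]; apply/negP => /eqP tS.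
pose supp S' := t ord0 (enum_rank S') != 0.
have neS S' : supp S' -> S' != S.
  by apply: contraTneq => ->; rewrite /supp tS eqxx.
(* Given [j] in [S'] outside [S] and [i] in [S] outside [S'], every member of the chain containing
   [i] contains [S'], hence [j]; so the degree at [i] is at most that at [j]. *)
have cmp S' : supp S' -> (S' \subset S) || (S \subset S').
  move=> tS'; have [//|/subsetPn[j jS' jS]] := boolP (S' \subset S).
  apply/fintype.subsetP => i iS; apply: contraPT (Slt _ _ iS jS) => iS'.
  apply/negP; rewrite -leNgt; apply: (degree_le tP) => S2 tS2 iS2.
  have /orP[/fintype.subsetP->//|/fintype.subsetP/(_ _ iS2)] :=
    realization_chain tP tS' tS2.
  by rewrite (negbTE iS').
have [[Sa tSa SaS]|noA] :=
    pselect (exists2 S', supp S' & S \subset S').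
  have [{}Sa [{}tSa {}SaS Samin]] :=
    realization_min (D := fun X => S \subset X) tP tSa SaS.
  have /properP[_ [j jSa jS]] : S \proper Sa.
    by rewrite finset.properEneq eq_sym neS.
  have [[Sb tSb SbS]|noB] := pselect (exists2 S', supp S' & S' \subset S).
    have [{}Sb [{}tSb {}SbS Sbmax]] :=
      realization_max (D := fun X => X \subset S) tP tSb SbS.
    have /properP[_ [i iS iSb]] : Sb \proper S by rewrite finset.properEneq neS.
    have := Slt _ _ iS jS; rewrite ltNge => /negP; apply.
    apply: (degree_le tP) => S2 tS2 iS2.
    have /orP[S2S|SS2] := cmp _ tS2.
      by have /fintype.subsetP/(_ _ iS2) := Sbmax _ tS2 S2S; rewrite (negbTE iSb).
    exact: (fintype.subsetP (Samin _ tS2 SS2)).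
  case/negP: jS; apply: S1; apply: (degree_eq1 tP) => S2 tS2.
  have /orP[S2S|SS2] := cmp _ tS2; first by case: noB; exists S2.
  exact: (fintype.subsetP (Samin _ tS2 SS2)).
have [Sb tSb] := realization_neq0 tP.
have SbS : Sb \subset S.
  by have /orP[//|SSb] := cmp _ tSb; case: noA; exists Sb.
have [{}Sb [{}tSb {}SbS Sbmax]] := realization_max (D := fun X => X \subset S) tP tSb SbS.
have /properP[_ [i iS iSb]] : Sb \proper S by rewrite finset.properEneq neS.
have /eqP := S0 _ iS; apply; apply: degree_eq0 => S2 tS2.
have /orP[S2S|SS2] := cmp _ tS2; last by case: noA; exists S2.
by apply: contra iSb; apply: (fintype.subsetP (Sbmax _ tS2 S2S)).
Qed.

(** The whole segment lies in the simplex spanned by the chain of [t]. *)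
Lemma realization_segment P t u (b : R) : 0 <= b <= 1 ->
    realization P t -> realization P u ->
    (forall j, u ord0 j != 0 -> t ord0 j != 0) ->
  realization P ((1 - b) *: u + b *: t).
Proof.
move=> /andP[b0 b1] [t0 t1 tP tch] [u0 u1 _ _] ut.
have nt j : ((1 - b) *: u + b *: t) ord0 j != 0 -> t ord0 j != 0.
  rewrite !mxE; apply: contra_neq => tj; rewrite tj mulr0 addr0.
  by have [->|/ut] := eqVneq (u ord0 j) 0; rewrite ?mulr0// tj eqxx.
split=> [i||i /nt|i j /nt ti /nt tj]; last 2 first.
- exact: tP.
- exact: tch.
- by rewrite !mxE addr_ge0// mulr_ge0// subr_ge0.
- under eq_bigr do rewrite !mxE.
  by rewrite big_split/= -!mulr_sumr t1 u1 !mulr1 subrK.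
Qed.

End OrderComplex.

(** * Radial projection to the Euclidean unit sphere *)

Section Normalize.
Context {R : realType} {n : nat}.
Implicit Types x : 'rV[R]_n.

Definition euclid x : R := Num.sqrt (\sum_i x ord0 i ^+ 2).
Definition normalize x : 'rV[R]_n := (euclid x)^-1 *: x.
Definition unit_sphere : set 'rV[R]_n := [set x | \sum_i x ord0 i ^+ 2 = 1].

Lemma euclid_gt0 x : x != 0 -> 0 < euclid x.
Proof.
move=> x0; rewrite sqrtr_gt0 lt_neqAle eq_sym.
rewrite sumr_ge0 ?andbT => [|i _]; last exact: sqr_ge0.
apply: contra x0; rewrite psumr_eq0 => [/allP x0|i _]; last exact: sqr_ge0.
apply/eqP/rowP => i; rewrite mxE.
by have := x0 i; rewrite mem_index_enum sqrf_eq0 => /(_ isT)/eqP.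
Qed.

Lemma normalize_sphere x : x != 0 -> unit_sphere (normalize x).
Proof.
move=> x0; rewrite /unit_sphere/=; under eq_bigr do rewrite mxE exprMn.
rewrite -mulr_sumr exprVn sqr_sqrtr.
  by rewrite mulVf// gt_eqF//; have := euclid_gt0 x0; rewrite sqrtr_gt0.
by apply: sumr_ge0 => i _; exact: sqr_ge0.
Qed.

Lemma normalize_id x : unit_sphere x -> normalize x = x.
Proof. by move=> x1; rewrite /normalize /euclid x1 sqrtr1 invr1 scale1r. Qed.

Lemma sphere_neq0 x : unit_sphere x -> x != 0.
Proof.
move=> x1; apply/eqP => x0; have := oner_neq0 R; rewrite -x1 big1 ?eqxx// => i _.
by rewrite x0 mxE expr0n.
Qed.

Lemma cvg_normalize (T : topologicalType) (f : T -> 'rV[R]_n) (x : T) :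
  f x != 0 -> f y @[y --> x] --> f x ->
  normalize (f y) @[y --> x] --> normalize (f x).
Proof.
move=> fx0 fx; apply: cvgZ => //; apply: cvgV; first by rewrite gt_eqF// euclid_gt0.
have sq : \sum_i f y ord0 i ^+ 2 @[y --> x] --> \sum_i f x ord0 i ^+ 2.
  apply: cvg_sum => i _; under eq_cvg do rewrite expr2.
  by rewrite expr2; apply: cvgM; exact: cvg_coord.
exact: (cvg_comp _ _ sq (@sqrt_continuous R _)).
Qed.

Lemma cvg_mulmxr (m : nat) (A : 'M[R]_(n, m)) (T : topologicalType)
    (f : T -> 'rV[R]_n) (x : T) :
  f y @[y --> x] --> f x -> f y *m A @[y --> x] --> f x *m A.
Proof.
have E z : f z *m A = \row_j \sum_i f z ord0 i * A i j.
  by apply/rowP => j; rewrite !mxE.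
move=> fx; rewrite E; under eq_cvg do rewrite E; apply: cvg_row => j.
by apply: cvg_sum => i _; apply: cvgM; [exact: cvg_coord|exact: cvg_cst].
Qed.

End Normalize.
Arguments unit_sphere : clear implicits.

(** * The polytope in affine coordinates and the rays from its interior point *)

Section PolytopeSphere.
Context {R : realType} {m n : nat}.
Variables (l0 : 'rV[R]_m) (A : 'M[R]_(n, m)).

(** In the application the rows of [A] form a basis of the space W of affine dependencies. *)
Definition affine_point (x : 'rV[R]_n) : 'rV[R]_m := l0 + x *m A.
Local Notation pt := affine_point.

(* Weak balancedness, in affine coordinates on the polytope. *)
Definition supports (S : {set 'I_m}) : Prop :=
  exists x, (forall i, 0 <= pt x ord0 i) /\
            (forall i, i \notin S -> pt x ord0 i = 0).

Lemma supportsS (S S' : {set 'I_m}) : S \subset S' -> supports S -> supports S'.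
Proof.
move=> /fintype.subsetP SS' [x [x0 xS]]; exists x; split=> // i iS'.
by apply: xS; apply: contra iS'; exact: SS'.
Qed.

Lemma affine_pointZ a x i : pt (a *: x) ord0 i = l0 ord0 i + a * (x *m A) ord0 i.
Proof. by rewrite /pt -scalemxAl mxE [X in _ + X]mxE. Qed.

Hypothesis l0_gt0 : forall i, 0 < l0 ord0 i.
(** Boundedness of the polytope: every ray from [l0] leaves the orthant. *)
Hypothesis A_neg : forall x : 'rV[R]_n, x != 0 -> exists i, (x *m A) ord0 i < 0.

(* The ray from [l0] in direction [x *m A] leaves the nonnegative orthant at
   time [1 / exit_speed x]. *)
Definition exit_speed (x : 'rV[R]_n) : R :=
  \big[Num.max/0]_i (- (x *m A) ord0 i / l0 ord0 i).

Lemma exit_speed_ge x i : - (x *m A) ord0 i / l0 ord0 i <= exit_speed x.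
Proof. exact: le_bigmax. Qed.

Lemma exit_speed_gt0 x : x != 0 -> 0 < exit_speed x.
Proof.
move=> /A_neg[i xi]; apply: lt_le_trans (exit_speed_ge x i).
by rewrite divr_gt0// oppr_gt0.
Qed.

(** The maximum has default value 0, which positivity of the exit speed rules out. *)
Lemma exit_speed_attained x : x != 0 ->
  exists i, exit_speed x = - (x *m A) ord0 i / l0 ord0 i.
Proof.
move=> x0; have p0 := exit_speed_gt0 x0.
apply: contrapT => nex; have := ltxx (exit_speed x); rewrite {1}/exit_speed.
move=> /bigmax_ltP; apply; split=> // i _; rewrite lt_neqAle exit_speed_ge andbT.
by apply/eqP => E; apply: nex; exists i.
Qed.

Lemma exit_point_ge0 (x : 'rV[R]_n) i : x != 0 -> 0 <= pt ((exit_speed x)^-1 *: x) ord0 i.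
Proof.
move=> x0; have p0 := exit_speed_gt0 x0.
(* Writing [l0 ord0 i] as p^-1 (p l0_i), with p the exit speed, lets the factor p^-1 be taken out of
   the sum. *)
rewrite affine_pointZ -[X in X + _](mulKf (lt0r_neq0 p0)) -mulrDr.
rewrite mulr_ge0 ?invr_ge0 ?(ltW p0)//.
have := exit_speed_ge x i; rewrite ler_pdivrMr// mulrC; lra.
Qed.

Lemma exit_point_eq0 (x : 'rV[R]_n) i : x != 0 ->
  (pt ((exit_speed x)^-1 *: x) ord0 i == 0) =
  (exit_speed x == - (x *m A) ord0 i / l0 ord0 i).
Proof.
move=> x0; have p0 := exit_speed_gt0 x0.
rewrite affine_pointZ -[X in X + _](mulKf (lt0r_neq0 p0)) -mulrDr.
rewrite mulf_eq0 invr_eq0 (gt_eqF p0)/= addr_eq0.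
have li := lt0r_neq0 (l0_gt0 i).
by apply/eqP/eqP => [<-|->]; rewrite ?mulfK ?divfK.
Qed.

Variable eps : R.
Hypothesis eps_gt0 : 0 < eps.
Hypothesis eps_supports : forall x, (forall i, 0 <= pt x ord0 i) ->
  supports [set i | eps <= pt x ord0 i]%SET.

(** The value is 1 exactly where the exit point is at least [eps]. Each strict superlevel set at a
    level below 1 contains that thick support, so it supports a point of the polytope. Zeros of the
    exit point are kept. *)
Definition clip x : 'rV[R]_m :=
  \row_i Num.min 1 (pt ((exit_speed x)^-1 *: x) ord0 i / eps).

(* The image of the order complex of proper supports in the cube. *)
Definition cube_complex (phi : 'rV[R]_m) : Prop :=
  [/\ cube phi, supports [set i | phi ord0 i == 1]%SET &
     exists i, phi ord0 i = 0].

Lemma clip_eq0 x i : (clip x ord0 i == 0) = (pt ((exit_speed x)^-1 *: x) ord0 i == 0).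
Proof.
rewrite mxE minEle; case: ifPn => [le1|_].
  rewrite oner_eq0; apply/esym/gt_eqF; rewrite ltNge; apply/negP => h.
  have : pt ((exit_speed x)^-1 *: x) ord0 i / eps <= 0.
    by rewrite pmulr_lle0// invr_gt0.
  by move=> /(le_trans le1); rewrite ler10.
by rewrite mulf_eq0 invr_eq0 (gt_eqF eps_gt0) orbF.
Qed.

Lemma clip_complex x : x != 0 -> cube_complex (clip x).
Proof.
move=> x0; split.
- move=> i; rewrite mxE le_min ler01 ge_min lexx/= andbT.
  by rewrite divr_ge0 ?(ltW eps_gt0)// exit_point_ge0.
- apply: supportsS (eps_supports (fun i => exit_point_ge0 i x0)).
  apply/fintype.subsetP => i; rewrite !inE => h.
  by rewrite mxE; apply/eqP/min_idPl; rewrite ler_pdivlMr// mul1r.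
- have [i pE] := exit_speed_attained x0; exists i.
  by apply/eqP; rewrite clip_eq0 exit_point_eq0// pE.
Qed.

Lemma cvg_affine_point (T : topologicalType) (f : T -> 'rV[R]_n) (x : T) :
  f y @[y --> x] --> f x -> pt (f y) @[y --> x] --> pt (f x).
Proof. by move=> fx; apply: cvgD; [exact: cvg_cst|exact: cvg_mulmxr]. Qed.

Lemma cvg_exit_speed (T : topologicalType) (f : T -> 'rV[R]_n) (x : T) :
  f y @[y --> x] --> f x -> exit_speed (f y) @[y --> x] --> exit_speed (f x).
Proof.
move=> fx; apply: cvg_bigmax => i; apply: cvgM; last exact: cvg_cst.
by apply: cvgN; apply: cvg_coord; exact: cvg_mulmxr.
Qed.

Lemma cvg_clip (T : topologicalType) (f : T -> 'rV[R]_n) (x : T) :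
  f x != 0 -> f y @[y --> x] --> f x -> clip (f y) @[y --> x] --> clip (f x).
Proof.
move=> fx0 fx; apply: cvg_row => i.
apply: (@continuous_min R T (fun=> 1)
  (fun y => pt ((exit_speed (f y))^-1 *: f y) ord0 i / eps)).
  exact: cvg_cst.
apply: cvgM; last exact: cvg_cst.
apply: cvg_coord; apply: (cvg_affine_point (f := fun y => (exit_speed (f y))^-1 *: f y)).
apply: cvgZ => //; apply: cvgV; first by rewrite gt_eqF// exit_speed_gt0.
exact: cvg_exit_speed.
Qed.

(** * Maps and homotopies for a poset [P] onto which [c] retracts the proper supports *)

Variables (P : {set 'I_m} -> Prop) (c : {set 'I_m} -> {set 'I_m}).
Hypothesis c_mono : {homo c : S S' / S \subset S'}.
Hypothesis c_sub : forall S, c S \subset S.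
Hypothesis P_proper : forall S, P S -> S != finset.setT.
Hypothesis P_fix : forall S, P S -> c S = S.
Hypothesis P_c : forall S, supports S -> S != finset.setT -> P (c S).
Variable xi : {set 'I_m} -> 'rV[R]_n.
Hypothesis xi_ge0 : forall S, P S -> forall i, 0 <= pt (xi S) ord0 i.
Hypothesis xi_eq0 : forall S, P S -> forall i, i \notin S -> pt (xi S) ord0 i = 0.

Local Notation K :=
  (order_complex_realization R (fun S T : {set 'I_m} => S \subset T) P).
Local Notation N := #|{set 'I_m}|.
Implicit Types t : 'rV[R]_N.

Lemma P_supports S : P S -> supports S.
Proof. by move=> PS; exists (xi S); split; [exact: xi_ge0|exact: xi_eq0]. Qed.

(** A set of positive weight contains the level set of 1, hence is a support, and misses a zero of
    [phi], hence is proper. *)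
Lemma cube_complex_push phi : cube_complex phi -> K (push c phi).
Proof.
move=> [cphi s1 [i phi0]]; apply: push_realization => // S /weight_neq0[S0 S1 _].
apply: P_c.
  by apply: supportsS s1; apply/fintype.subsetP => j; rewrite inE => /eqP/S1.
by apply/eqP => ST; have := S0 i; rewrite ST inE phi0 eqxx => /(_ isT).
Qed.

(** The degree is 1 on the smallest member of the chain and 0 outside the largest. *)
Lemma degree_complex t : K t -> cube_complex (degree t).
Proof.
move=> Kt; have [S tS] := realization_neq0 Kt; split.
- exact: degree_cube Kt.
- have [S0 [tS0 _ S0min]] := realization_min (D := xpredT) Kt tS isT.
  have [_ _ /(_ _ tS0)] := Kt; rewrite enum_rankK => PS0 _.
  apply: supportsS (P_supports PS0); apply/fintype.subsetP => i iS0; rewrite inE.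
  apply/eqP; apply: (degree_eq1 Kt) => S' tS'.
  exact: (fintype.subsetP (S0min _ tS' isT)).
- have [S1 [tS1 _ S1max]] := realization_max (D := xpredT) Kt tS isT.
  have [_ _ /(_ _ tS1)] := Kt; rewrite enum_rankK => /P_proper S1T _.
  have /subsetPn[i _ iS1] : ~~ (finset.setT \subset S1) by rewrite finset.subTset.
  exists i; apply: degree_eq0 => S' tS'.
  by apply: contra iS1; apply: (fintype.subsetP (S1max _ tS' isT)).
Qed.

Definition barycenter t : 'rV[R]_n := \sum_j t ord0 j *: xi (enum_val j).

Lemma affine_point_barycenter t i : K t ->
  pt (barycenter t) ord0 i = \sum_j t ord0 j * pt (xi (enum_val j)) ord0 i.
Proof.
move=> [_ t1 _ _]; rewrite /pt mxE -[l0 ord0 i]mul1r -t1 mulr_suml.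
rewrite mulmx_suml summxE -big_split/=; apply: eq_bigr => j _.
by rewrite -scalemxAl !mxE mulrDr.
Qed.

Lemma barycenter_ge0 t i : K t -> 0 <= pt (barycenter t) ord0 i.
Proof.
move=> Kt; rewrite affine_point_barycenter//; apply: sumr_ge0 => j _.
have [->|tj] := eqVneq (t ord0 j) 0; first by rewrite mul0r.
by case: Kt => t0 _ /(_ _ tj) Pj _; rewrite mulr_ge0// xi_ge0.
Qed.

Lemma barycenter_eq0 t i : K t ->
  (forall S, t ord0 (enum_rank S) != 0 -> i \notin S) ->
  pt (barycenter t) ord0 i = 0.
Proof.
move=> Kt iS; rewrite affine_point_barycenter// big1// => j _.
have [->|tj] := eqVneq (t ord0 j) 0; first by rewrite mul0r.
case: Kt => _ _ /(_ _ tj) Pj _; rewrite (xi_eq0 Pj) ?mulr0//.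
by apply: iS; rewrite enum_valK.
Qed.

Lemma degree_eq0_notin t i : K t -> degree t ord0 i = 0 ->
  forall S, t ord0 (enum_rank S) != 0 -> i \notin S.
Proof.
move=> [t0 _ _ _]; rewrite mxE => /eqP; rewrite psumr_eq0// => /allP h S tS.
apply/negP => iS; have := h (enum_rank S) (mem_index_enum _).
by rewrite enum_rankK iS/= (negbTE tS).
Qed.

Lemma barycenter_degree_eq0 t i : K t -> degree t ord0 i = 0 ->
  pt (barycenter t) ord0 i = 0.
Proof. by move=> Kt ti; apply: barycenter_eq0 => //; exact: degree_eq0_notin. Qed.

(** The origin corresponds to [l0], which is positive everywhere, whereas the barycenter vanishes
    outside the largest member of the chain. *)
Lemma barycenter_neq0 t : K t -> barycenter t != 0.
Proof.
move=> Kt; have [_ _ [i ti]] := degree_complex Kt.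
apply/eqP => b0; have := l0_gt0 i.
have := barycenter_degree_eq0 Kt ti.
by rewrite b0 /pt mul0mx addr0 => ->; rewrite ltxx.
Qed.

Lemma cvg_barycenter (T : topologicalType) (f : T -> 'rV[R]_N) (x : T) :
  f y @[y --> x] --> f x -> barycenter (f y) @[y --> x] --> barycenter (f x).
Proof.
move=> fx; apply: cvg_big => [|j _]; first exact: add_continuous.
by apply: cvgZr_tmp; exact: cvg_coord.
Qed.

(** The barycenter b has a zero coordinate, so it is itself the exit point of its ray. Indeed the
    quotients defining the exit speed of b/|b| are |b|^-1 (1 - pt(b)_j / l0_j), at most |b|^-1, with
    equality where b vanishes in the polytope. *)
Lemma clip_barycenter_eq0 t i : K t -> degree t ord0 i = 0 ->
  clip (normalize (barycenter t)) ord0 i = 0.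
Proof.
move=> Kt ti; have b0 := barycenter_neq0 Kt; have e0 := euclid_gt0 b0.
have n0 := sphere_neq0 (normalize_sphere b0).
apply/eqP; rewrite clip_eq0 exit_point_eq0//; apply/eqP/le_anti.
rewrite exit_speed_ge andbT.
have ptE j : (barycenter t *m A) ord0 j = pt (barycenter t) ord0 j - l0 ord0 j.
  rewrite /affine_point [X in X - _]mxE; ring.
have normE j : - (normalize (barycenter t) *m A) ord0 j / l0 ord0 j =
    (euclid (barycenter t))^-1 * (1 - pt (barycenter t) ord0 j / l0 ord0 j).
  rewrite -scalemxAl mxE ptE; have := lt0r_neq0 (l0_gt0 j).
  by move=> li; field; rewrite li lt0r_neq0.
rewrite normE (barycenter_degree_eq0 Kt ti) mul0r subr0 mulr1.
apply/bigmax_leP; split=> [|j _]; first by rewrite invr_ge0 ltW.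
rewrite normE ger_pMr ?invr_gt0// gerBl divr_ge0 ?(ltW (l0_gt0 j))//.
exact: barycenter_ge0.
Qed.

(** The function whose coefficient is 1 keeps its level set of 1 inside that of the maximum, and a
    zero of [phi] is a zero of both. *)
Lemma cube_complex_max phi psi (a b : R) :
    cube_complex phi -> cube_complex psi ->
    (forall i, phi ord0 i = 0 -> psi ord0 i = 0) ->
    0 <= a <= 1 -> 0 <= b <= 1 -> a = 1 \/ b = 1 ->
  cube_complex (\row_i Num.max (a * phi ord0 i) (b * psi ord0 i)).
Proof.
move=> [cphi phi1 [i phi0]] [cpsi psi1 _] phipsi /andP[a0 a1] /andP[b0 b1] ab.
have le1 (u v : R) : 0 <= u <= 1 -> 0 <= v <= 1 -> u * v <= 1.
  by move=> /andP[u0 u1] /andP[v0 v1]; exact: mulr_ile1.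
have H j : a * phi ord0 j <= 1 /\ b * psi ord0 j <= 1.
  by split; apply: le1; rewrite ?a0 ?b0.
split.
- move=> j; rewrite mxE le_max ge_max mulr_ge0//=; last by case/andP: (cphi j).
  by case: (H j) => -> ->.
- case: ab => [a1'|b1'].
    apply: supportsS phi1; apply/fintype.subsetP => j; rewrite !inE mxE => /eqP phij.
    have [_ ?] := H j.
    by rewrite phij a1' mulr1 (max_idPl _).
  apply: supportsS psi1; apply/fintype.subsetP => j; rewrite !inE mxE => /eqP psij.
  have [? _] := H j.
  by rewrite psij b1' mulr1 (max_idPr _).
- by exists i; rewrite mxE phi0 phipsi// !mulr0 maxxx.
Qed.


Definition to_complex x : 'rV[R]_N := push c (clip x).
Definition to_sphere t : 'rV[R]_n := normalize (barycenter t).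

Lemma to_complex_in x : unit_sphere R n x -> K (to_complex x).
Proof.
by move=> x1; apply: cube_complex_push; apply: clip_complex; exact: sphere_neq0.
Qed.

Lemma to_sphere_in t : K t -> unit_sphere R n (to_sphere t).
Proof. by move=> Kt; apply: normalize_sphere; exact: barycenter_neq0. Qed.

Lemma cvg_to_complex (T : topologicalType) (f : T -> 'rV[R]_n) (x : T) :
  f x != 0 -> f y @[y --> x] --> f x ->
  to_complex (f y) @[y --> x] --> to_complex (f x).
Proof.
move=> fx0 fx; apply: (cvg_push (f := fun y => clip (f y))).
  by have [] := clip_complex fx0.
exact: cvg_clip.
Qed.

Lemma cvg_to_sphere (T : topologicalType) (f : T -> 'rV[R]_N) (x : T) :
  K (f x) -> f y @[y --> x] --> f x ->
  to_sphere (f y) @[y --> x] --> to_sphere (f x).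
Proof.
move=> Kfx fx; apply: (cvg_normalize (f := fun y => barycenter (f y))).
  exact: barycenter_neq0.
exact: cvg_barycenter.
Qed.

(** At a coordinate [i] attaining the exit speed of [x], the clipped function vanishes, so every
    member of the resulting chain avoids [i]. Hence both ends of the segment [L] have a negative
    image under [A] at [i], and the segment misses the origin. *)
Lemma to_sphere_complex_homotopic :
  homotopic R (unit_sphere R n) (unit_sphere R n) (to_sphere \o to_complex) id.
Proof.
pose L (p : R * 'rV[R]_n) := (1 - p.1) *: barycenter (to_complex p.2) + p.1 *: p.2.
have L0 p : 0 <= p.1 <= 1 -> unit_sphere R n p.2 -> L p != 0.
  case: p => s x /= /andP[s0 s1] x1; have x0 := sphere_neq0 x1.
  have Kx := to_complex_in x1.
  have [i xi0] := exit_speed_attained x0.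
  have clip0 : clip x ord0 i = 0 by apply/eqP; rewrite clip_eq0 exit_point_eq0// xi0.
  have p0 := exit_speed_gt0 x0; have li := l0_gt0 i.
  have : pt (barycenter (to_complex x)) ord0 i = 0.
    apply: barycenter_eq0 => // S /push_neq0[S' /weight_neq0[S'0 _ _]].
    rewrite enum_rankK => <-; apply/negP => /(fintype.subsetP (c_sub S')) /S'0.
    by rewrite clip0 eqxx.
  rewrite -[barycenter _ in X in X -> _]scale1r affine_pointZ mul1r => b0.
  have xE : (x *m A) ord0 i = - (exit_speed x * l0 ord0 i).
    by rewrite xi0 divfK ?opprK// lt0r_neq0.
  apply/eqP => /(congr1 (fun z => (z *m A) ord0 i)).
  rewrite mul0mx [RHS]mxE /L/= mulmxDl -!scalemxAl mxE [X in X + _]mxE [X in _ + X]mxE xE.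
  have -> : (barycenter (to_complex x) *m A) ord0 i = - l0 ord0 i by lra.
  have : 0 < exit_speed x * l0 ord0 i by exact: mulr_gt0.
  move: (exit_speed x * _) => q q0; apply/eqP; rewrite lt_eqF//.
  have [->|s_neq1] := eqVneq s 1; first by rewrite subrr mul0r add0r mul1r oppr_lt0.
  have : 0 < (1 - s) * l0 ord0 i by rewrite mulr_gt0// subr_gt0 lt_neqAle s_neq1.
  have : 0 <= s * q by rewrite mulr_ge0// ltW.
  by lra.
exists (fun p => normalize (L p)); split.
- apply: continuous_in_subspaceT => p; rewrite inE => -[p01 p1].
  apply: cvg_normalize; first exact: L0.
  have p2 : snd q @[q --> p] --> snd p by exact: cvg_snd.
  have p1' : fst q @[q --> p] --> fst p by exact: cvg_fst.
  apply: cvgD; apply: cvgZ => //; first by apply: cvgB => //; exact: cvg_cst.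
  by apply: cvg_barycenter; apply: cvg_to_complex => //; exact: sphere_neq0.
- by move=> x x1; rewrite /L/= subr0 scale1r scale0r addr0.
- by move=> x x1; rewrite /L/= subrr scale0r scale1r add0r normalize_id.
- by move=> s x s01 x1; apply: normalize_sphere; exact: L0.
Qed.

(* The homotopy grows the degree function up to the maximum of both maps, then
   shrinks the other map, then moves linearly from [push c (degree t)] to [t]. *)
Lemma to_complex_sphere_homotopic : homotopic R K K (to_complex \o to_sphere) id.
Proof.
(* On the first third [a] rises to 1 while [b] is 1; on the second [b] falls to 0 while [a] is 1; on
   the last [e] rises from 0 to 1. *)
pose a (s : R) : R := Num.min 1 (3 * s).
pose b (s : R) : R := Num.max 0 (Num.min 1 (2 - 3 * s)).
pose e (s : R) : R := Num.max 0 (3 * s - 2).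
pose Phi (p : R * 'rV[R]_N) : 'rV[R]_m :=
  \row_i Num.max (a p.1 * degree p.2 ord0 i) (b p.1 * clip (to_sphere p.2) ord0 i).
have PhiX p : 0 <= p.1 <= 1 -> K p.2 -> cube_complex (Phi p).
  case: p => s t /= /andP[s0 s1] Kt; apply: cube_complex_max.
  - exact: degree_complex.
  - by apply: clip_complex; apply: sphere_neq0; exact: to_sphere_in.
  - by move=> i; exact: clip_barycenter_eq0.
  - by rewrite /a ge_min lexx le_min ler01/= andbT mulr_ge0.
  - by rewrite /b le_max lexx ge_max ler01 ge_min lexx.
  - have /orP[s3|s3] := le_total (3 * s) 1; [right|left].
      have h : 1 <= 2 - 3 * s by lra.
      by rewrite /b (min_idPl h) (max_idPr ler01).
    by rewrite /a (min_idPl s3).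
have e01 s : 0 <= s <= 1 -> 0 <= e s <= 1.
  by move=> /andP[s0 s1]; rewrite /e le_max lexx ge_max ler01/=; lra.
have ePhi s t : 0 < e s -> K t -> Phi (s, t) = degree t.
  rewrite /e lt_max ltxx/= => s2 Kt; apply/rowP => i; rewrite mxE/= /a /b.
  have h1 : 1 <= 3 * s by lra.
  have h2 : 2 - 3 * s <= 0 by lra.
  have h3 : 2 - 3 * s <= 1 by lra.
  rewrite (min_idPl h1) (min_idPr h3) (max_idPl h2) mul0r mul1r.
  by apply/max_idPl; have /andP[] := degree_cube Kt i.
exists (fun p => (1 - e p.1) *: push c (Phi p) + e p.1 *: p.2); split.
- apply: continuous_in_subspaceT => p; rewrite inE => -[p01 Kp].
  have p2 : snd q @[q --> p] --> snd p by exact: cvg_snd.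
  have p1 : fst q @[q --> p] --> fst p by exact: cvg_fst.
  have p3 : 3 * fst q @[q --> p] --> 3 * fst p.
    by apply: cvgM => //; exact: cvg_cst.
  have pe : e (fst q) @[q --> p] --> e (fst p).
    rewrite /e.
    apply: (@continuous_max R (R * 'rV[R]_N)%type (fun=> 0) (fun q => 3 * fst q - 2)).
      exact: cvg_cst.
    by apply: cvgB => //; exact: cvg_cst.
  apply: cvgD; apply: cvgZ => //; first by apply: cvgB => //; exact: cvg_cst.
  apply: cvg_push; first by have [] := PhiX _ p01 Kp.
  apply: cvg_row => i.
  apply: (@continuous_max R (R * 'rV[R]_N)%type (fun q => a q.1 * degree q.2 ord0 i)
    (fun q => b q.1 * clip (to_sphere q.2) ord0 i)); apply: cvgM.
  + rewrite /a.
    apply: (@continuous_min R (R * 'rV[R]_N)%type (fun=> 1) (fun q => 3 * fst q)) => //.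
    exact: cvg_cst.
  + by apply: cvg_coord; exact: cvg_degree.
  + rewrite /b.
    apply: (@continuous_max R (R * 'rV[R]_N)%type (fun=> 0) (fun q => Num.min 1 (2 - 3 * fst q))).
      exact: cvg_cst.
    apply: (@continuous_min R (R * 'rV[R]_N)%type (fun=> 1) (fun q => 2 - 3 * fst q)).
      exact: cvg_cst.
    by apply: cvgB => //; exact: cvg_cst.
  + apply: cvg_coord; apply: (cvg_clip (f := fun q => to_sphere q.2)).
      by apply: sphere_neq0; exact: to_sphere_in.
    exact: cvg_to_sphere.
- have h : 0 - 2 <= 0 :> R by lra.
  have h1 : 1 <= 2 :> R by lra.
  move=> t Kt; rewrite /= /e mulr0 (max_idPl h) subr0 scale1r scale0r addr0; congr push.
  apply/rowP => i; rewrite mxE /a /b/=.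
  rewrite mulr0 subr0 (min_idPr ler01) (min_idPl h1) (max_idPr ler01) mul0r mul1r.
  apply/max_idPr.
  have := clip_complex (sphere_neq0 (to_sphere_in Kt)).
  by move=> [/(_ i)/andP[]].
- have h : 3 * 1 - 2 = 1 :> R by lra.
  by move=> t Kt; rewrite /= /e h (max_idPr ler01) subrr scale0r scale1r add0r.
- move=> s t s01 Kt /=; have es := e01 _ s01.
  have KPhi : K (push c (Phi (s, t))) by apply: cube_complex_push; exact: PhiX.
  have [e0|e0] := eqVneq (e s) 0.
    by rewrite e0 subr0 scale1r scale0r addr0.
  (* For positive [e s] the sets of positive weight belong to the chain of [t], and [c] fixes them
     as members of [P]; so the pushed point is supported in that chain. *)
  apply: realization_segment => // j.
  rewrite ePhi//; last by rewrite lt_neqAle eq_sym e0; case/andP: es.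
  move=> /push_neq0[S /(weight_degree Kt) tS cS].
  have [_ _ /(_ _ tS)] := Kt; rewrite enum_rankK => /P_fix cSS _.
  by rewrite -(enum_valK j) -cS cSS.
Qed.

Lemma order_complex_polytope_sphere :
  homotopy_equivalent R K (unit_sphere R n).
Proof.
exists to_sphere, to_complex; split.
- split; last by move=> _ [t Kt <-]; exact: to_sphere_in.
  apply: continuous_in_subspaceT => t; rewrite inE => Kt.
  exact: (cvg_to_sphere (f := id)).
- split; last by move=> _ [x x1 <-]; exact: to_complex_in.
  apply: continuous_in_subspaceT => x; rewrite inE => /sphere_neq0 x0.
  exact: (cvg_to_complex (f := id)).
- exact: to_complex_sphere_homotopic.
- exact: to_sphere_complex_homotopic.
Qed.

End PolytopeSphere.

(** * Balanced sets as supports of positive coefficients *)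

Section Balanced.
Context {R : realType} {m d : nat}.
Variables (v : 'I_m -> 'rV[R]_d).
Implicit Types (S : {set 'I_m}) (x y r : 'rV[R]_d) (l u : 'rV[R]_m).

(* Homogeneous coordinates turn affine combinations into matrix products. *)
Definition hom_mx : 'M[R]_(m, d + 1) := \matrix_i row_mx (v i) 1%:M.
Definition hom x : 'rV[R]_(d + 1) := row_mx x 1%:M.

Lemma mul_hom_mx u :
  u *m hom_mx = row_mx (\sum_i u ord0 i *: v i) (\sum_i u ord0 i)%:M.
Proof.
apply/rowP => j; rewrite [LHS]mxE; case: (split_ordP j) => k ->.
  by rewrite row_mxEl summxE; apply: eq_bigr => i _; rewrite [_ i _]mxE row_mxEl mxE.
rewrite row_mxEr ord1 mxE mulr1n; apply: eq_bigr => i _.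
by rewrite [hom_mx _ _]mxE row_mxEr mxE mulr1.
Qed.

Lemma hom_mxP u x :
  u *m hom_mx = hom x <-> \sum_i u ord0 i = 1 /\ x = \sum_i u ord0 i *: v i.
Proof.
rewrite mul_hom_mx; split=> [/eq_row_mx[<- /matrixP/(_ ord0 ord0)]|[-> <-]//].
by rewrite !mxE !mulr1n.
Qed.

Lemma hom_mx_eq0 u :
  u *m hom_mx = 0 <-> \sum_i u ord0 i = 0 /\ \sum_i u ord0 i *: v i = 0.
Proof.
rewrite mul_hom_mx -(row_mx0 _ 1 d 1); split=> [/eq_row_mx[-> /matrixP/(_ ord0 ord0)]|[-> ->]].
  by rewrite !mxE mulr1n.
by rewrite raddf0.
Qed.

Lemma convP S x : Defs.conv v S x <->
  exists l, [/\ forall i, 0 <= l ord0 i, forall i, i \notin S -> l ord0 i = 0 &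
    l *m hom_mx = hom x].
Proof.
split=> [[l [l0 lS l1 xE]]|[l [l0 lS /hom_mxP[l1 xE]]]]; last first.
  by exists (l ord0).
exists (\row_i l i); split=> [i|i|]; rewrite ?mxE//; first exact: lS.
apply/hom_mxP; split; first by under eq_bigr do rewrite mxE.
by rewrite xE; apply: eq_bigr => i _; rewrite mxE.
Qed.

Lemma affP S x : Defs.aff v S x <->
  exists l, (forall i, i \notin S -> l ord0 i = 0) /\ l *m hom_mx = hom x.
Proof.
split=> [[l [lS l1 xE]]|[l [lS /hom_mxP[l1 xE]]]]; last first.
  by exists (l ord0).
exists (\row_i l i); split=> [i|]; rewrite ?mxE//; first exact: lS.
apply/hom_mxP; split; first by under eq_bigr do rewrite mxE.
by rewrite xE; apply: eq_bigr => i _; rewrite mxE.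
Qed.

Lemma delta_hom_mx i : delta_mx ord0 i *m hom_mx = hom (v i).
Proof. by rewrite -rowE rowK. Qed.

Lemma rV_coord_le (p : nat) (x : 'rV[R]_p) j : `|x ord0 j| <= `|x|.
Proof.
by rewrite [leRHS]/Num.norm/= mx_normrE; apply: (le_bigmax _ _ (ord0, j)).
Qed.

Lemma hom_comb (a b : R) x y : a + b = 1 ->
  a *: hom x + b *: hom y = hom (a *: x + b *: y).
Proof.
by move=> ab; rewrite /hom !scale_row_mx add_row_mx -scalerDl ab scale1r.
Qed.

(** A point [y] of the affine hull near [x] differs from it by a combination of points of [S] whose
    coefficients are bounded linearly in the distance, through a pseudo-inverse. Small coefficients
    leave [l] nonnegative. *)
Lemma positive_balanced S x l :
  (forall i, i \in S -> 0 < l ord0 i) -> (forall i, i \notin S -> l ord0 i = 0) ->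
  l *m hom_mx = hom x -> balanced v x S.
Proof.
move=> lpos l0 lx; have l_ge0 i : 0 <= l ord0 i.
  by have [/lpos/ltW|/l0->] := boolP (i \in S).
split; first by apply/convP; exists l; split.
pose D : 'M[R]_(m, d + 1) := \matrix_i (if i \in S then row i hom_mx else 0).
have DE u : (forall i, i \notin S -> u ord0 i = 0) -> u *m D = u *m hom_mx.
  move=> uS; rewrite !mulmx_sum_row; apply: eq_bigr => i _; rewrite rowK.
  by case: ifPn => // /uS->; rewrite !scale0r.
(* The last homogeneous coordinate of [z] is 0, so only the upper rows of the pseudo-inverse act. *)
pose Q := usubmx (pinvmx D).
pose C i := \sum_j `|Q j i|.
have C0 i : 0 <= C i by exact: sumr_ge0.
pose e := \big[Num.min/1]_(i in S) (l ord0 i / (1 + C i)).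
have e_le i : i \in S -> e <= l ord0 i / (1 + C i) by move=> iS; exact: bigmin_le_cond.
exists e.
  rewrite /e; apply/bigmin_gtP; split => // i iS.
  by rewrite divr_gt0 ?lpos// ltr_wpDr.
move=> y /affP[a [aS ay]] ye; apply/convP.
pose z : 'rV[R]_(d + 1) := row_mx (y - x) 0.
have zE : z = (a - l) *m hom_mx.
  by rewrite mulmxBl ay lx /hom opp_row_mx add_row_mx subrr.
have bD : (z *m pinvmx D) *m D = z.
  apply: mulmxKpV; rewrite zE -DE ?submxMl// => i iS.
  by rewrite !mxE aS// l0// subrr.
pose b := (y - x) *m Q.
have bE : z *m pinvmx D = b.
  by rewrite /z -[pinvmx D]vsubmxK mul_row_col mul0mx addr0.
pose b' : 'rV[R]_m := \row_i (if i \in S then b ord0 i else 0).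
have b'E : b' *m hom_mx = z.
  rewrite -DE; last by move=> i iS; rewrite mxE (negbTE iS).
  rewrite -bD bE !mulmx_sum_row; apply: eq_bigr => i _; rewrite rowK mxE.
  by case: ifP => // _; rewrite !scaler0.
exists (l + b'); split.
- move=> i; rewrite mxE [b' _ _]mxE; case: ifPn => [iS|/l0->]; last by rewrite addr0.
  suff : `|b ord0 i| <= l ord0 i by rewrite ler_norml => /andP[+ _]; lra.
  rewrite mxE (le_trans (ler_norm_sum _ _ _))//.
  apply: (@le_trans _ _ (`|y - x| * C i)).
    rewrite mulr_sumr; apply: ler_sum => j _; rewrite normrM ler_wpM2r//.
    exact: rV_coord_le.
  apply: (@le_trans _ _ (l ord0 i / (1 + C i) * (1 + C i))); last first.
    by rewrite divfK// gt_eqF// ltr_wpDr.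
  apply: ler_pM => //; last by rewrite lerDr.
  by apply: le_trans (e_le _ iS); exact: ltW.
- by move=> i iS; rewrite !mxE (negbTE iS) l0// addr0.
- by rewrite mulmxDl b'E lx /hom /z add_row_mx addr0 addrC subrK.
Qed.

Variable r : 'rV[R]_d.

(** The union of the supports of the points of L supported in [S]. For weakly balanced [S] it is the
    largest balanced subset. *)
Definition core S : {set 'I_m} :=
  [set i | `[< exists l, [/\ forall j, 0 <= l ord0 j,
      forall j, j \notin S -> l ord0 j = 0, l *m hom_mx = hom r
      & 0 < l ord0 i] >]]%SET.

Lemma coreP S i : i \in core S <-> exists l, [/\ forall j, 0 <= l ord0 j,
      forall j, j \notin S -> l ord0 j = 0, l *m hom_mx = hom r
      & 0 < l ord0 i].
Proof. by rewrite inE; split=> /asboolP. Qed.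

Lemma core_sub S : core S \subset S.
Proof.
apply/fintype.subsetP => i /coreP[l [_ lS _ li]]; apply: contraTT li => iS.
by rewrite lS// ltxx.
Qed.

Lemma core_mono : {homo core : S S' / S \subset S'}.
Proof.
move=> S S' /fintype.subsetP SS'; apply/fintype.subsetP => i /coreP[l [l0 lS lr li]].
by apply/coreP; exists l; split=> // j jS'; apply: lS; apply: contra jS'; exact: SS'.
Qed.

(** For each index of the core choose a point of L positive there, for every other index any point
    supported in [S], and average these [m] points. *)
Lemma core_positive S : weakly_balanced v r S ->
  exists l, [/\ forall i, i \in core S -> 0 < l ord0 i,
    forall i, i \notin core S -> l ord0 i = 0 & l *m hom_mx = hom r].
Proof.
move=> /convP[l [l0 lS lr]].
have : forall i, exists u, [/\ forall j, 0 <= u ord0 j,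
    forall j, j \notin S -> u ord0 j = 0, u *m hom_mx = hom r
    & i \in core S -> 0 < u ord0 i].
  move=> i; have [/coreP[u [u0 uS ur ui]]|] := boolP (i \in core S).
    by exists u; split.
  by exists l; split.
move=> /choice[u uP].
have m0 : m%:R != 0 :> R.
  rewrite pnatr_eq0; apply/eqP => m0; have /hom_mxP[l1 _] := lr.
  have := oner_neq0 R; rewrite -l1 big1 ?eqxx// => i _.
  by have := ltn_ord i; rewrite [X in (_ < X)%N]m0.
have mV0 : 0 < m%:R^-1 :> R by rewrite invr_gt0 lt0r m0 ler0n.
exists (m%:R^-1 *: \sum_i u i); split.
- move=> i iC; rewrite mxE summxE mulr_gt0// (bigD1 i)//= ltr_wpDr//.
    by apply: sumr_ge0 => j _; case: (uP j).
  by case: (uP i) => _ _ _ /(_ iC).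
- move=> i iC; rewrite mxE summxE big1 ?mulr0// => j _.
  apply/eqP; apply: contraNT iC => uji; apply/coreP; exists (u j).
  by have [u0 uS ur _] := uP j; split => //; rewrite lt_neqAle eq_sym uji u0.
- rewrite -scalemxAl mulmx_suml (eq_bigr (fun=> hom r)) => [|j _]; last first.
    by case: (uP j).
  by rewrite sumr_const card_ord -[hom r *+ m]scaler_nat scalerA mulVf// scale1r.
Qed.

Lemma core_balanced S : weakly_balanced v r S -> balanced v r (core S).
Proof. by move=> /core_positive[l [? ? ?]]; exact: (positive_balanced (l := l)). Qed.

(** Moving [r] slightly away from [v i] stays in the convex hull. Adding the right multiple of [v i]
    back and rescaling writes [r] with a positive coefficient at [i]. *)
Lemma balanced_core S : balanced v r S -> core S = S.
Proof.
move=> [/convP[l [l0 lS lr]] [e e0 re]]; apply/eqP; rewrite finset.eqEsubset core_sub.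
apply/fintype.subsetP => i iS; pose t := e / (1 + `|r - v i|).
have n0 : 0 < 1 + `|r - v i| by rewrite ltr_wpDr.
have t0 : 0 < t by rewrite divr_gt0.
have t1 : 1 + t != 0 by rewrite gt_eqF// addr_gt0.
have : Defs.conv v S ((1 + t) *: r + (- t) *: v i).
  apply: re.
    apply/affP; exists ((1 + t) *: l + (- t) *: delta_mx ord0 i); split.
      move=> j jS; rewrite !mxE lS//=.
      by have [ij|_] := eqVneq j i; [rewrite ij iS in jS|rewrite !mulr0 addr0].
    by rewrite mulmxDl -!scalemxAl lr delta_hom_mx hom_comb// addrK.
  have -> : (1 + t) *: r + (- t) *: v i - r = t *: (r - v i).
    by rewrite scalerBr scalerDl scale1r scaleNr -[r + _ - _]addrA addrAC subrr add0r.
  rewrite normrZ gtr0_norm// /t mulrAC ltr_pdivrMr// ltr_pM2l// ltrDr.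
  exact: ltr01.
move=> /convP[a [a0 aS ar]]; apply/coreP.
exists ((1 + t)^-1 *: (a + t *: delta_mx ord0 i)).
have tV0 : 0 < (1 + t)^-1 by rewrite invr_gt0 addr_gt0.
split.
- by move=> j; rewrite !mxE mulr_ge0 ?(ltW tV0)// addr_ge0// mulr_ge0 ?(ltW t0)// ler0n.
- move=> j jS; rewrite !mxE aS//=.
  by have [ij|_] := eqVneq j i; [rewrite ij iS in jS|rewrite !mulr0 addr0 mulr0].
- rewrite -scalemxAl mulmxDl -scalemxAl ar delta_hom_mx -hom_comb ?addrK//.
  by rewrite scaleNr subrK scalerA mulVf// scale1r.
- by rewrite !mxE !eqxx mulr1 mulr_gt0// ltr_wpDl.
Qed.

End Balanced.

(** * Dimension of the space of affine dependencies *)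

Section AffineDependencies.
Context {R : realType} {m d : nat}.
Variable v : 'I_m -> 'rV[R]_d.

(** Vectors of coordinate sum zero have dimension m - 1, and [f] maps them onto the span of the
    differences of the points. The dependencies are the kernel of this restriction, and the rows of
    [A] are a basis of it. *)
Lemma affine_dependencies : (0 < m)%N ->
  exists n (A : 'M[R]_(n, m)), [/\ (n + aff_dim v).+1 = m,
    forall x : 'rV[R]_n, x *m A = 0 -> x = 0 &
    forall u : 'rV[R]_m,
      u *m hom_mx v = 0 <-> exists x : 'rV[R]_n, u = x *m A].
Proof.
move=> m_gt0; pose i0 := Ordinal m_gt0.
pose f : 'Hom('rV[R]_m, 'rV[R]_d) := linfun (mulmxr (\matrix_i v i)).
pose s : 'Hom('rV[R]_m, 'rV[R]_1) := linfun (mulmxr (const_mx 1)).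
have fE u : f u = \sum_i u ord0 i *: v i.
  by rewrite lfunE /= mulmx_sum_row; apply: eq_bigr => i _; rewrite rowK.
have sE u : s u = (\sum_i u ord0 i)%:M.
  rewrite lfunE /=; apply/rowP => j; rewrite ord1 !mxE mulr1n.
  by apply: eq_bigr => i _; rewrite mxE mulr1.
have sP u : (u \in lker s) = (\sum_i u ord0 i == 0).
  rewrite memv_ker sE; apply/eqP/eqP => [/matrixP/(_ ord0 ord0)|->].
    by rewrite !mxE mulr1n.
  by rewrite raddf0.
have dim_s : \dim (lker s) = m.-1.
  have := limg_ker_dim s fullv; rewrite capfv.
  have -> : (s @: fullv)%VS = fullv.
    apply/vspaceP => w; rewrite memvf; apply/memv_imgP.
    exists (w *m delta_mx ord0 i0); rewrite ?memvf// sE.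
    apply/rowP => j; rewrite ord1 mxE mulr1n (bigD1 i0)//= big1 => [|i ii0].
      by rewrite addr0 mxE big_ord1 mxE !eqxx mulr1.
    by rewrite mxE big_ord1 mxE (negbTE ii0) andbF mulr0.
  by rewrite !dimvf !dim_matrix !mul1r addn1 => /(congr1 predn).
pose D := [seq v i - v j | i <- enum 'I_m, j <- enum 'I_m].
have im_f : (f @: lker s)%VS = <<D>>%VS.
  apply/eqP; rewrite eqEsubv; apply/andP; split.
    apply/subvP => w /memv_imgP[u]; rewrite sP => /eqP u0 ->.
    have -> : f u = \sum_i u ord0 i *: (v i - v i0).
      under eq_bigr do rewrite scalerBr.
      by rewrite sumrB -scaler_suml u0 scale0r subr0 fE.
    apply: memv_suml => i _; apply: memvZ; apply: memv_span.
    by apply: allpairs_f; rewrite mem_enum.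
  apply/span_subvP => w /allpairsP[[i j] /= [_ _ ->]].
  have sum_delta k : \sum_i (delta_mx ord0 k : 'rV[R]_m) ord0 i = 1.
    rewrite (bigD1 k)//= big1 => [|l lk]; first by rewrite mxE !eqxx addr0.
    by rewrite mxE (negbTE lk) andbF.
  apply/memv_imgP; exists (delta_mx ord0 i - delta_mx ord0 j).
    rewrite sP; under eq_bigr do rewrite mxE [X in _ + X]mxE.
    by rewrite sumrB !sum_delta subrr.
  have f_delta k : f (delta_mx ord0 k) = v k by rewrite lfunE /= -rowE rowK.
  by rewrite linearB /= !f_delta.
pose W := (lker s :&: lker f)%VS.
have WP u : u \in W <-> u *m hom_mx v = 0.
  rewrite memv_cap sP memv_ker fE hom_mx_eq0.
  by split=> [/andP[/eqP ? /eqP ?]|[-> ->]]; rewrite ?eqxx.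
exists (\dim W), (\matrix_(j < \dim W) (vbasis W)`_j).
have AE x : x *m \matrix_(j < \dim W) (vbasis W)`_j =
    \sum_j x ord0 j *: (vbasis W)`_j.
  by rewrite mulmx_sum_row; apply: eq_bigr => j _; rewrite rowK.
split.
- have := limg_ker_dim f (lker s); rewrite im_f dim_s -/W /aff_dim -/D => ->.
  by rewrite prednK.
- move=> x; rewrite AE => x0; apply/rowP => j; rewrite mxE.
  by have /freeP := basis_free (vbasisP W); apply.
- move=> u; rewrite -WP; split=> [uW|[x ->]].
    exists (\row_j coord (vbasis W) j u); rewrite AE [LHS](coord_vbasis uW).
    by apply: eq_bigr => j _; rewrite mxE.
  rewrite AE; apply: memv_suml => j _; apply: memvZ; apply: vbasis_mem.
  by rewrite mem_nth// size_tuple.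
Qed.

End AffineDependencies.

(** * A uniform threshold for supports, by compactness *)

Section ThickSupports.
Context {R : realType} {m d : nat}.
Variables (v : 'I_m -> 'rV[R]_d) (r : 'rV[R]_d).
Implicit Types (S : {set 'I_m}) (l : 'rV[R]_m).

Definition weights : set 'rV[R]_m :=
  [set l : 'rV[R]_m | (forall i, 0 <= l ord0 i) /\ l *m hom_mx v = hom r].

Lemma compact_weights : compact weights.
Proof.
have cbox : compact [set l : 'rV[R]_m | forall i, `[0 : R, 1]%classic (l ord0 i)].
  by apply: (@rV_compact _ _ (fun=> `[0 : R, 1]%classic)) => _; exact: segment_compact.
apply: (subclosed_compact _ cbox); last first.
  move=> l [l0 /hom_mxP[l1 _]] i; rewrite /= in_itv/= l0/= -l1 (bigD1 i)//=.
  by rewrite lerDl sumr_ge0.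
have -> : weights = (\bigcap_i [set l : 'rV[R]_m | 0 <= l ord0 i]) `&`
    (\bigcap_j [set l : 'rV[R]_m | (l *m hom_mx v) ord0 j = hom r ord0 j]).
  apply/seteqP; split=> l [l0 lr]; split.
  - by move=> i _; exact: l0.
  - by move=> j _ /=; rewrite lr.
  - by move=> i; exact: l0.
  - by apply/rowP => j; exact: lr.
apply: closedI; apply: closed_bigI => j _.
  apply: (@closed_comp _ _ (fun l : 'rV[R]_m => l ord0 j) [set x | 0 <= x]).
    by move=> l _; exact: coord_continuous.
  exact: closed_ge.
apply: (@closed_comp _ _ (fun l : 'rV[R]_m => (l *m hom_mx v) ord0 j)
  [set x | x = hom r ord0 j]).
  by move=> l _; apply: cvg_coord; apply: (cvg_mulmxr (f := id)).
exact: closed_eq.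
Qed.

(** For nonnegative [l] this vanishes exactly when [l] is supported in [S]. *)
Definition max_outside S l : R :=
  \big[Num.max/0]_i (if i \in S then 0 else l ord0 i).

Lemma cvg_max_outside (T : topologicalType) S (f : T -> 'rV[R]_m) (x : T) :
  f y @[y --> x] --> f x ->
  max_outside S (f y) @[y --> x] --> max_outside S (f x).
Proof.
move=> fx; apply: cvg_bigmax => i.
by case: ifP => _; [exact: cvg_cst|exact: cvg_coord].
Qed.

(** For each [S] that is not weakly balanced, [max_outside S] has a positive minimum on the compact
    set of weights. Below all these finitely many minima, a thick support that failed to be weakly
    balanced would miss an index where [l] is at least the threshold. *)
Lemma thick_support_conv : exists2 e : R, 0 < e &
  forall l, weights l -> Defs.conv v [set i | e <= l ord0 i]%SET r.
Proof.
have step S : exists e : R, 0 < e /\ (~ Defs.conv v S r ->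
    forall l, weights l -> exists2 i, i \notin S & e <= l ord0 i).
  have [rS|rS] := pselect (Defs.conv v S r); first by exists 1.
  have [w0|/nonemptyPn w0] := pselect (weights !=set0); last first.
    by exists 1; split=> // _ l; rewrite w0.
  have [|c /set_mem[c0 cr] cmin] := EVT_min_rV (f := max_outside S) w0 compact_weights.
    apply: continuous_subspaceT => l.
    exact: (cvg_max_outside (f := id)).
  have out_c : 0 < max_outside S c.
    rewrite ltNge; apply: contra_notN rS => /bigmax_leP[_ cS].
    apply/convP; exists c; split=> // i iS; apply/le_anti; rewrite c0 andbT.
    by have := cS i isT; rewrite (negbTE iS).
  exists (max_outside S c); split=> // _ l wl; have := cmin l (mem_set wl).
  move=> cl; apply: contrapT => nex; have := cl; rewrite leNgt => /negP; apply.
  apply/bigmax_ltP; split => // i _; case: ifPn => // iS.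
  by rewrite ltNge; apply/negP => h; apply: nex; exists i.
have [e eP] := choice step.
exists (\big[Num.min/1]_S e S).
  by apply/bigmin_gtP; split => // S _; case: (eP S).
move=> l wl; apply: contrapT => /(proj2 (eP _)) /(_ _ wl)[i].
rewrite inE -ltNge => lt1 le1.
have := lt_le_trans lt1 (le_trans (bigmin_le _ _ _) le1).
by rewrite ltxx.
Qed.

End ThickSupports.

(** The common form of both equivalences: [P] is the fixed poset of a monotone shrinking map [c],
    either [id] or [core]. *)
Lemma balanced_poset_sphere (R : realType) (m d : nat) (v : 'I_m -> 'rV[R]_d)
    (r : 'rV[R]_d) (P : {set 'I_m} -> Prop) (c : {set 'I_m} -> {set 'I_m}) :
    balanced v r finset.setT ->
    {homo c : S S' / S \subset S'} -> (forall S, c S \subset S) ->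
    (forall S, P S -> [/\ S != finset.setT, weakly_balanced v r S & c S = S]) ->
    (forall S, weakly_balanced v r S -> S != finset.setT -> P (c S)) ->
  homotopy_equivalent R
    (order_complex_realization R (fun S T : {set 'I_m} => S \subset T) P)
    (sphere R (m%:Z - (aff_dim v)%:Z - 2)).
Proof.
move=> bT c_mono c_sub P_wb wb_P.
have [l0 [l0_gt0 _ l0r]] := core_positive bT.1.
have {}l0_gt0 i : 0 < l0 ord0 i by apply: l0_gt0; rewrite balanced_core// inE.
have m_gt0 : (0 < m)%N.
  rewrite lt0n; apply/eqP => m0; have /hom_mxP[l1 _] := l0r.
  have := oner_neq0 R; rewrite -l1 big1 ?eqxx// => i _.
  by have := ltn_ord i; rewrite [X in (_ < X)%N]m0.
have [n [A [nE A_inj A_ker]]] := affine_dependencies v m_gt0.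
have A_neg (x : 'rV[R]_n) : x != 0 -> exists i, (x *m A) ord0 i < 0.
  move=> x0; apply: contrapT => nex; case/eqP: x0; apply: A_inj.
  (* The coordinates of a dependency sum to zero, so they vanish if none is negative. *)
  have /hom_mx_eq0[/eqP + _] : (x *m A) *m hom_mx v = 0 by apply/A_ker; exists x.
  have xA0 i : 0 <= (x *m A) ord0 i.
    by rewrite leNgt; apply/negP => xi; apply: nex; exists i.
  rewrite psumr_eq0// => /allP xA; apply/rowP => i; rewrite [RHS]mxE.
  exact/eqP/xA/mem_index_enum.
have ptP l : l *m hom_mx v = hom r <-> exists x, l = affine_point l0 A x.
  split=> [lr|[x ->]].
    have /A_ker[x xE] : (l - l0) *m hom_mx v = 0 by rewrite mulmxBl lr l0r subrr.
    by exists x; rewrite /affine_point -xE addrC subrK.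
  rewrite mulmxDl l0r (_ : _ *m hom_mx v = 0) ?addr0//.
  by apply/A_ker; exists x.
have supP S : supports l0 A S <-> weakly_balanced v r S.
  rewrite /weakly_balanced convP; split=> [[x [x0 xS]]|[l [l0' lS /ptP[x lE]]]].
    by exists (affine_point l0 A x); split=> //; apply/ptP; exists x.
  by exists x; rewrite -lE.
have [eps eps_gt0 thick] := thick_support_conv v r.
have : forall S, exists x : 'rV[R]_n, P S ->
    (forall i, 0 <= affine_point l0 A x ord0 i) /\
    (forall i, i \notin S -> affine_point l0 A x ord0 i = 0).
  move=> S; have [PS|nPS] := pselect (P S); last by exists 0.
  by have [_ /supP[x xP] _] := P_wb _ PS; exists x.
move=> /choice[xi xiP].
(* The ambient dimension of the sphere is n = m - k - 1, so the sign condition in [sphere] holds;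
   for n = 0 both spheres are empty. *)
have zE : m%:Z - (aff_dim v)%:Z - 2 + 1 = n%:Z.
  by rewrite -[X in X%:Z - _]nE; lia.
have -> : sphere R (m%:Z - (aff_dim v)%:Z - 2) = unit_sphere R _.
  by apply/seteqP; split=> [x []//|x x1]; split=> //; rewrite zE.
rewrite zE absz_nat.
apply: (@order_complex_polytope_sphere R m n l0 A l0_gt0 A_neg
  eps eps_gt0 _ P c _ _ _ _ _ xi) => //.
- move=> x x0; apply/supP; apply: thick; split=> //.
  by apply/ptP; exists x.
- by move=> S /P_wb[].
- by move=> S /P_wb[].
- by move=> S /supP; exact: wb_P.
- by move=> S /xiP[].
- by move=> S /xiP[].
Qed.

Unset Implicit Arguments.

Theorem theorem2 (R : realType) (m d k : nat) (v : 'I_m -> 'rV[R]_d)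
  (r : 'rV[R]_d) :
  injective v ->
  (exists S : {set 'I_m}, B_poset v r S) ->
  balanced v r (finset.setT : {set 'I_m}) ->
  aff_dim v = k ->
  homotopy_equivalent R
    (order_complex_realization R (fun S T : {set 'I_m} => S \subset T)
       (B_poset v r))
    (sphere R (m%:Z - k%:Z - 2)) /\
  homotopy_equivalent R
    (order_complex_realization R (fun S T : {set 'I_m} => S \subset T)
       (Bbar_poset v r))
    (sphere R (m%:Z - k%:Z - 2)).
Proof.
move=> _ _ bT <-; split.
  apply: (@balanced_poset_sphere _ _ _ _ _ _ id bT) => //.
  by move=> S [].
apply: (@balanced_poset_sphere _ _ _ _ _ _ (core v r) bT) => //.
- exact: core_mono.
- exact: core_sub.
- by move=> S [ST bS]; split=> //; [exact: bS.1|exact: balanced_core].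
- move=> S wS ST; split; last exact: core_balanced.
  apply: contra ST => /eqP cT.
  by rewrite -finset.subTset -cT core_sub.
Qed.
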